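(* For every real number $t$ with $1/2 < t < 1$, there exists a region $\Omega \subset \mathbb{R}^2$ that is a finite union of squares and such that the squares of sidelength $n^{-t}$ for $n \geq 1$ (one square for each natural number $n \geq 1$) can perfectly pack $\Omega$.
   Context: All rectangles and squares are subsets of $\mathbb{R}^2$ with sides parallel to the coordinate axes, and are topologically closed. A packing by rectangles of a region $\Omega \subset \mathbb{R}^2$ is a finite or countably infinite family of rectangles contained in $\Omega$ with (pairwise) disjoint interiors. A packing is perfect if the rectangles cover $\Omega$ up to Lebesgue null sets. Saying that a list of squares of prescribed sidelengths ''can perfectly pack'' $\Omega$ means that there is a perfect packing of $\Omega$ by a family consisting of exactly one square of each prescribed sidelength in the list. *)

(* Defs.v *)
From HB Require Import structures.
From mathcomp Require Import all_boot all_order all_algebra.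
From mathcomp Require Import all_classical all_reals all_analysis.
Set Implicit Arguments.
Unset Strict Implicit.
Unset Printing Implicit Defensive.
Import Order.TTheory GRing.Theory Num.Theory.
Import numFieldNormedType.Exports.
Local Open Scope classical_set_scope.
Local Open Scope ring_scope.

Definition rectangle {R : realType} (x y w h : R) : set (R * R) :=
  `[x, x + w] `*` `[y, y + h].

Definition is_rectangle {R : realType} (Q : set (R * R)) : Prop :=
  exists x y w h : R, [/\ 0 < w, 0 < h & Q = rectangle x y w h].

Definition is_square_of_side {R : realType} (s : R) (Q : set (R * R)) : Prop :=
  0 < s /\ exists x y : R, Q = rectangle x y s s.

Definition is_square {R : realType} (Q : set (R * R)) : Prop :=
  exists s : R, is_square_of_side s Q.

Definition is_finite_union_of_squares {R : realType}
    (Omega : set (R * R)) : Prop :=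
  exists F : set (set (R * R)),
    [/\ finite_set F, F `<=` is_square & Omega = \bigcup_(S in F) S].

(* The product measure is defined on the Borel sets; [negligible] allows any
   subset of a Borel set of measure zero, that is, any Lebesgue null set. *)
Definition lebesgue_null2 {R : realType} (N : set (R * R)) : Prop :=
  (@lebesgue_measure R \x @lebesgue_measure R)%E.-negligible N.

(* A family is indexed by the elements of [D]; [Q] is irrelevant outside [D]. *)
Definition is_packing {R : realType} {I : Type} (D : set I)
    (Q : I -> set (R * R)) (Omega : set (R * R)) : Prop :=
  [/\ countable D,
      forall i, D i -> is_rectangle (Q i),
      forall i, D i -> Q i `<=` Omega
    & trivIset D (fun i => (Q i)°)].

Definition is_perfect_packing {R : realType} {I : Type} (D : set I)
    (Q : I -> set (R * R)) (Omega : set (R * R)) : Prop :=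
  is_packing D Q Omega /\ lebesgue_null2 (Omega `\` \bigcup_(i in D) Q i).

Definition squares_can_perfectly_pack {R : realType} {I : Type} (D : set I)
    (side : I -> R) (Omega : set (R * R)) : Prop :=
  exists Q : I -> set (R * R),
    (forall i, D i -> is_square_of_side (side i) (Q i)) /\
    is_perfect_packing D Q Omega.

(* Main.v *)
Require Import Defs.
From mathcomp Require Import all_boot all_order all_algebra.
From mathcomp Require Import all_classical all_reals all_analysis.
From mathcomp Require Import zify ring lra.
Import Order.TTheory GRing.Theory Num.Theory.
Import numFieldNormedType.Exports.
Local Open Scope classical_set_scope.
Local Open Scope ring_scope.

(** The squares of side [j ^ -t] with [1 <= j < n0], together with one square whose
area is the tail sum [T n0] of the [j ^ (-2t)] over [j >= n0], are placed apart
from each other; their union is [Omega].  That extra square is filled greedily by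
all the remaining squares.  At each time what is left of it is a finite list of
boxes of total area exactly [T n], where [n] is the next square to place.
Since [T n] tends to 0, what is never covered is a null set
([null_of_small_covers]), so the only question is whether the greedy procedure
can go on forever.

One step takes a left-over box both of whose sides exceed [m * s], where
[s = n ^ -t] and [m] is a large constant, cuts a strip of height [s] from its
bottom, and puts squares [n, n + 1, ..., n + k - 1] in the strip from left to
right until no more fit ([dissects_strip]).  The waste is a very thin box above each square (of height
at most [(k / n) * s]) and one end box with both sides at most [s].

A box of sides [w], [h] is given the weight [w ^ d * h + h ^ d * w], with
[d = 1 - t].  This perimeter discounts thin boxes.  With an undiscounted
perimeter ([d = 0]) the waste of all the stacks up to time [n] would be of order
[n ^ (1 - t)], the same order as what can be afforded.  With the discount, the
thin boxes weigh little because [k / n] is small, and the end box is shared by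
the at least [m] squares of its stack, so that the waste per square is at most
[(4 / m) * s ^ (1 + d)] ([stack_waste]).  Since
[s ^ (1 + d) = n ^ (a - 1)] with [a = (1 - t) ^ 2 > 0], the total weight stays
below the budget [B * n ^ a] with [B = 8 / (m * a)].

Conversely a box with one side at most [m * s] has area at most
[(m * s) ^ (1 - d)] times its weight ([thin_area]).  If every left-over box were
of this kind, the total area would be at most
[m ^ t * B * n ^ (1 - 2t)], a multiple of [n ^ (1 - 2t)] by a constant of order
[m ^ (t - 1)]; but [T n >= n ^ (1 - 2t) / 4] ([tail_ge]).  Hence for [m] large
there always is a box both of whose sides exceed [m * s]
([stage_has_wide_box]), and the step can be made ([next_stage]). *)

(** * Boxes and dissections *)

(** A pair (lower left corner, (width, height)).  Degenerate boxes are allowed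
as cutting residues. *)
Definition box (R : realType) : Type := ((R * R) * (R * R))%type.

Definition dims {R : realType} (r : box R) : R * R := r.2.

Definition region {R : realType} (r : box R) : set (R * R) :=
  rectangle r.1.1 r.1.2 r.2.1 r.2.2.

Definition in_closed {R : realType} (p : R * R) (r : box R) : bool :=
  (r.1.1 <= p.1 <= r.1.1 + r.2.1) && (r.1.2 <= p.2 <= r.1.2 + r.2.2).

Definition in_open {R : realType} (p : R * R) (r : box R) : bool :=
  (r.1.1 < p.1 < r.1.1 + r.2.1) && (r.1.2 < p.2 < r.1.2 + r.2.2).

Definition area {R : realType} (d : R * R) : R := d.1 * d.2.

Definition unit_dims {R : realType} (d : R * R) : bool :=
  (0 <= d.1 <= 1) && (0 <= d.2 <= 1).

(** [L'] can stand in for [L]: the same area, the same union, and no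
more overlap of the interiors at any point.  Stating disjointness by a count
makes it additive in the lists and insensitive to their order, so dissections
can be composed, put side by side and permuted. *)
Definition dissects {R : realType} (L L' : seq (box R)) : Prop :=
  [/\ \sum_(r <- L) area (dims r) = \sum_(r <- L') area (dims r),
      forall p, (count (in_open p) L' <= count (in_open p) L)%N
    & forall p, has (in_closed p) L = has (in_closed p) L'].

Lemma dissects_perm {R : realType} (L L' : seq (box R)) :
  perm_eq L L' -> dissects L L'.
Proof.
move=> LL'; split=> [|p|p]; first exact: perm_big.
- by rewrite (permP LL').
- by rewrite !has_count (permP LL').
Qed.

Lemma dissects_refl {R : realType} (L : seq (box R)) : dissects L L.
Proof. exact: dissects_perm. Qed.

Lemma dissects_trans {R : realType} (L1 L2 L3 : seq (box R)) :
  dissects L1 L2 -> dissects L2 L3 -> dissects L1 L3.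
Proof.
move=> [a1 o1 c1] [a2 o2 c2]; split=> [|p|p]; first by rewrite a1.
- exact: leq_trans (o2 p) (o1 p).
- by rewrite c1.
Qed.

Lemma dissects_cat {R : realType} (L1 L1' L2 L2' : seq (box R)) :
  dissects L1 L1' -> dissects L2 L2' -> dissects (L1 ++ L2) (L1' ++ L2').
Proof.
move=> [a1 o1 c1] [a2 o2 c2]; split=> [|p|p].
- by rewrite !big_cat /= a1 a2.
- by rewrite !count_cat leq_add.
- by rewrite !has_cat c1 c2.
Qed.

Lemma dissects_vcut {R : realType} (x y w h u : R) : 0 <= u <= w ->
  dissects [:: ((x, y), (w, h))]
           [:: ((x, y), (u, h)); ((x + u, y), (w - u, h))].
Proof.
move=> u_bnd; split=> [|p|p].
- by rewrite !big_cons !big_nil /area /=; ring.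
- rewrite /= /in_open /=.
  case: (ltrP y p.2) => ?; case: (ltrP p.2 (y + h)) => ?;
    rewrite /= ?andbF ?andbT //.
  case: (ltrP x p.1) => ?; case: (ltrP p.1 (x + w)) => ?;
    case: (ltrP p.1 (x + u)) => ?; case: (ltrP (x + u) p.1) => ?;
    case: (ltrP p.1 (x + u + (w - u))) => ? //=; exfalso; lra.
- rewrite /= /in_closed /=.
  case: (lerP y p.2) => ?; case: (lerP p.2 (y + h)) => ?;
    rewrite /= ?andbF ?andbT //.
  case: (lerP x p.1) => ?; case: (lerP p.1 (x + w)) => ?;
    case: (lerP p.1 (x + u)) => ?; case: (lerP (x + u) p.1) => ?;
    case: (lerP p.1 (x + u + (w - u))) => ? //=; exfalso; lra.
Qed.

Lemma dissects_hcut {R : realType} (x y w h u : R) : 0 <= u <= h ->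
  dissects [:: ((x, y), (w, h))]
           [:: ((x, y), (w, u)); ((x, y + u), (w, h - u))].
Proof.
move=> u_bnd; split=> [|p|p].
- by rewrite !big_cons !big_nil /area /=; ring.
- rewrite /= /in_open /=.
  case: (ltrP x p.1) => ?; case: (ltrP p.1 (x + w)) => ?;
    rewrite /= ?andbF ?andbT //.
  case: (ltrP y p.2) => ?; case: (ltrP p.2 (y + h)) => ?;
    case: (ltrP p.2 (y + u)) => ?; case: (ltrP (y + u) p.2) => ?;
    case: (ltrP p.2 (y + u + (h - u))) => ? //=; exfalso; lra.
- rewrite /= /in_closed /=.
  case: (lerP x p.1) => ?; case: (lerP p.1 (x + w)) => ?;
    rewrite /= ?andbF ?andbT //.
  case: (lerP y p.2) => ?; case: (lerP p.2 (y + h)) => ?;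
    case: (lerP p.2 (y + u)) => ?; case: (lerP (y + u) p.2) => ?;
    case: (lerP p.2 (y + u + (h - u))) => ? //=; exfalso; lra.
Qed.

(** A stack: squares of sides [s n, s (n + 1), ...] stand side by side at the
bottom of a strip.  [E] lists the gaps above them, and [e] is the end of the
strip. *)
Lemma dissects_strip {R : realType} (s : nat -> R) (k n : nat) (x y w h : R) :
  (forall j, 0 <= s j) -> (forall j, (n <= j)%N -> s j <= h) ->
  \sum_(j <- iota n k) s j <= w ->
  exists (Q E : seq (box R)) (e : box R),
    [/\ map dims Q = [seq (s j, s j) | j <- iota n k],
        map dims E = [seq (s j, h - s j) | j <- iota n k],
        dims e = (w - \sum_(j <- iota n k) s j, h)
      & dissects [:: ((x, y), (w, h))] (Q ++ e :: E)].
Proof.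
move=> s_ge0; elim: k n x w => [|k IHk] n x w sh sw.
  exists [::], [::], ((x, y), (w, h)); rewrite /= big_nil subr0.
  by split=> //; exact: dissects_refl.
move: sw; rewrite /= !big_cons => sw.
have S0 : 0 <= \sum_(j <- iota n.+1 k) s j by apply: sumr_ge0.
have sh' j : (n.+1 <= j)%N -> s j <= h by move=> /ltnW; exact: sh.
have sw' : \sum_(j <- iota n.+1 k) s j <= w - s n by rewrite lerBrDl.
have [Q [E [e [dQ dE de cutQ]]]] := IHk n.+1 (x + s n) (w - s n) sh' sw'.
exists (((x, y), (s n, s n)) :: Q), (((x, y + s n), (s n, h - s n)) :: E), e.
split; [by rewrite /= dQ|by rewrite /= dE|by rewrite de opprD addrA|].
have sn_w : 0 <= s n <= w by rewrite s_ge0 (le_trans _ sw)// lerDl.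
have sn_h : 0 <= s n <= h by rewrite s_ge0 sh.
apply: dissects_trans (dissects_vcut x y w h (s n) sn_w) _.
have cut1 := dissects_hcut x y (s n) h (s n) sn_h.
apply: dissects_trans (dissects_cat _ _ _ _ cut1 cutQ) _.
apply: dissects_perm; apply/permP => a.
by rewrite !count_cat /=; clear; lia.
Qed.

(** * Power estimates, weights and the waste of a stack *)

(** Concavity of the power function at 1, from Young's inequality for the pair
[x ^ a], [1] with exponents [1 / a] and [1 / (1 - a)]. *)
Lemma powR_le_tangent {R : realType} (a x : R) : 0 < a < 1 -> 0 <= x ->
  x `^ a <= 1 + a * (x - 1).
Proof.
move=> /andP[a0 a1] x0.
have pq : (a^-1)^-1 + ((1 - a)^-1)^-1 = 1 by rewrite !invrK; ring.
have := @conjugate_powR R (x `^ a) 1 a^-1 (1 - a)^-1 (powR_ge0 _ _) ler01.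
rewrite !invr_gt0 a0 subr_gt0 a1 => /(_ isT isT pq).
rewrite mulr1 -powRrM mulfV ?gt_eqF// powRr1// powR1 !invrK mul1r.
lra.
Qed.

(** The tangent bound at the ratio [n / (n + k)]; it gives the growth of the
weight budget during one stack. *)
Lemma powR_increment {R : realType} (a n k : R) : 0 < a < 1 -> 0 < n -> 0 <= k ->
  a * k * (n + k) `^ (a - 1) <= (n + k) `^ a - n `^ a.
Proof.
move=> a01 n0 k0; have nk0 : 0 < n + k by lra.
have := powR_le_tangent a (n / (n + k)) a01 (divr_ge0 (ltW n0) (ltW nk0)).
have -> : n / (n + k) - 1 = - (k / (n + k)) by field; lra.
have -> : n `^ a = (n / (n + k)) `^ a * (n + k) `^ a.
  by rewrite -powRM ?divfK ?gt_eqF ?divr_ge0 ?ltW.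
have -> : (n + k) `^ (a - 1) = (n + k) `^ a / (n + k).
  by rewrite powRB ?powRr1 ?ltW// (gt_eqF nk0) implybT.
have := powR_gt0 a nk0.
set P := _ `^ a; set Q := _ `^ a => P0 PQ.
have -> : a * k * (P / (n + k)) = P * (a * (k / (n + k))) by ring.
have -> : P - Q * P = P * (1 - Q) by ring.
rewrite ler_pM2l//; lra.
Qed.

(** A discrete integral comparison for the series of the [n ^ (- b - 1)]: its
terms are dominated by a telescoping sequence. *)
Lemma powR_decrement {R : realType} (b n : R) : 0 < b < 1 -> 1 < n ->
  b * n `^ (- b - 1) <= (n - 1) `^ (- b) - n `^ (- b).
Proof.
move=> b01 n1; have n0 : 0 < n by lra.
have np0 : 0 < n - 1 by lra.
have := powR_le_tangent b ((n - 1) / n) b01 (divr_ge0 (ltW np0) (ltW n0)).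
have -> : (n - 1) / n - 1 = - n^-1 by field; lra.
have -> : (n - 1) `^ (- b) = ((n - 1) / n) `^ (- b) * n `^ (- b).
  by rewrite -powRM ?divfK ?gt_eqF ?divr_ge0 ?ltW.
have -> : n `^ (- b - 1) = n `^ (- b) / n.
  by rewrite powRB ?powRr1 ?ltW// (gt_eqF n0) implybT.
have Q0 : 0 < ((n - 1) / n) `^ b by rewrite powR_gt0 ?divr_gt0.
rewrite [_ `^ (- b) in X in _ -> _ <= X - _]powRN.
have := powR_gt0 (- b) n0.
move: Q0; set P := _ `^ (- b); set Q := _ `^ b => Q0 P0 Qle.
have -> : b * (P / n) = P * (b * n^-1) by ring.
have -> : Q^-1 * P - P = P * (Q^-1 - 1) by ring.
rewrite ler_pM2l//.
have bn : b * n^-1 >= 0 by rewrite mulr_ge0 ?invr_ge0; lra.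
rewrite lerBrDl.
have : 1 <= Q^-1 * (1 - b / n).
  by rewrite mulrC ler_pdivlMr// mul1r; lra.
move: (Q^-1) (invr_gt0 Q); rewrite Q0 => q q0.
move: bn; set u := b / n => u0 H.
nra.
Qed.

(** A perimeter in which thin boxes count for little.  Up to a factor 2 it is
(shorter side) ^ [d] times the longer side; the symmetric sum is monotone in
each side without case distinction. *)
Definition weight {R : realType} (d : R) (p : R * R) : R :=
  p.1 `^ d * p.2 + p.2 `^ d * p.1.

Lemma weight_le {R : realType} (d w h w' h' : R) : 0 <= d ->
  0 <= w <= w' -> 0 <= h <= h' -> weight d (w, h) <= weight d (w', h').
Proof.
move=> d0 /andP[w0 ww'] /andP[h0 hh']; rewrite /weight /=.
have [w'0 h'0] := (le_trans w0 ww', le_trans h0 hh').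
by rewrite lerD// ler_pM ?powR_ge0// ge0_ler_powR.
Qed.

(** If [w <= c], write [w * h] as [w ^ (1 - d)] times [w ^ d * h]. *)
Lemma thin_area {R : realType} (d c : R) (p : R * R) : 0 <= d < 1 ->
  0 <= p.1 -> 0 <= p.2 -> (p.1 <= c) || (p.2 <= c) ->
  area p <= c `^ (1 - d) * weight d p.
Proof.
have key (w h : R) : 0 <= d < 1 -> 0 <= w -> 0 <= h -> w <= c ->
    w * h <= c `^ (1 - d) * (w `^ d * h + h `^ d * w).
  move=> /andP[d0 d1] w0 h0 wc.
  have -> : w * h = w `^ (1 - d) * (w `^ d * h).
    by rewrite mulrA -powRD ?subrK ?powRr1// oner_eq0.
  rewrite ler_pM ?powR_ge0 ?mulr_ge0 ?powR_ge0//.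
    by rewrite ge0_ler_powR ?nnegrE ?subr_ge0 ?(ltW d1)// (le_trans w0 wc).
  by rewrite lerDl mulr_ge0 ?powR_ge0.
move=> d01 w0 h0 /orP[wc|hc]; rewrite /area /weight; first exact: key.
by rewrite [p.1 * p.2]mulrC [p.1 `^ d * _ + _]addrC key.
Qed.

Definition side {R : realType} (t : R) (n : nat) : R := n%:R `^ (- t).

Lemma side_ge0 {R : realType} (t : R) n : 0 <= side t n.
Proof. exact: powR_ge0. Qed.

Lemma side_gt0 {R : realType} (t : R) n : (0 < n)%N -> 0 < side t n.
Proof. by move=> n0; rewrite powR_gt0// ltr0n. Qed.

Lemma powRN_le {R : realType} (t x y : R) : 0 <= t -> 0 < x -> x <= y ->
  y `^ (- t) <= x `^ (- t).
Proof.
move=> t0 x0 xy; have y0 := lt_le_trans x0 xy.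
rewrite !powRN lef_pV2 ?posrE ?powR_gt0// ge0_ler_powR// nnegrE; exact: ltW.
Qed.

Lemma side_le {R : realType} (t : R) n j : 0 <= t -> (0 < n <= j)%N ->
  side t j <= side t n.
Proof. by move=> t0 /andP[n0 nj]; rewrite powRN_le ?ltr0n ?ler_nat. Qed.

Lemma side_le1 {R : realType} (t : R) n : 0 <= t -> (0 < n)%N -> side t n <= 1.
Proof.
by move=> t0 n0; rewrite (le_trans (@side_le R t 1 n _ _))// /side powR1.
Qed.

(** Nearby squares have nearly equal sides, since
[(1 + rho) ^ (- t) >= (1 + rho)^-1 >= 1 - rho]. *)
Lemma side_drop {R : realType} (t rho : R) n j : 0 <= t <= 1 -> (0 < n <= j)%N ->
  0 <= rho -> j%:R <= (1 + rho) * n%:R ->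
  0 <= side t n - side t j <= rho * side t n.
Proof.
move=> /andP[t0 t1] nj r0 jr; rewrite subr_ge0 side_le//=.
have [n0 j0] : (0 < n)%N /\ (0 < j)%N by lia.
have r1 : 0 < 1 + rho by lra.
have : ((1 + rho) * n%:R) `^ (- t) <= side t j.
  by rewrite powRN_le ?ltr0n.
rewrite powRM ?(ltW r1)// -/(side t n).
have : (1 + rho) `^ (- 1) <= (1 + rho) `^ (- t).
  by rewrite ler_powR; lra.
rewrite powR_inv1 ?(ltW r1)//.
have : 1 - rho <= (1 + rho)^-1.
  by rewrite -[X in _ <= X]mul1r ler_pdivlMr//; nra.
have := side_gt0 t n n0.
set q := _^-1; set p := _ `^ _; set S := side t n; set S' := side t j.
nra.
Qed.

(** The key estimate: what a stack of [k] squares adds to the weight is paid for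
by the growth of the budget from [n] to [n + k].  The end box costs
[2 * s ^ (1 + d)], which is at most [2 / m] per square as [m <= k]; each gap is
at most [s] by [rho * s] and costs at most [2 * rho ^ d * s ^ (1 + d)], again
[2 / m] per square.  The budget grows by at least half of
[a * k * n ^ (a - 1) * 8 / (m * a)], that is [4 / m] per square. *)
Lemma stack_waste {R : realType} (t rho m : R) (n k : nat) :
  0 < t < 1 -> 0 < m -> (0 < n)%N -> m <= k%:R ->
  0 < rho <= 1 -> rho `^ (1 - t) <= m^-1 -> k%:R <= rho * n%:R ->
  weight (1 - t) (side t n, side t n) +
    \sum_(j <- iota n k) weight (1 - t) (side t j, side t n - side t j)
  <= 8 / (m * (1 - t) ^+ 2) *
     ((n + k)%:R `^ ((1 - t) ^+ 2) - n%:R `^ ((1 - t) ^+ 2)).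
Proof.
move=> t01 m0 n0 mk rho01 rhom krho.
have n0R : 0 < n%:R :> R by rewrite ltr0n.
set s := side t n; set d := 1 - t; set a := d ^+ 2.
have a01 : 0 < a < 1 by rewrite /a /d; nra.
have d01 : 0 < d < 1 by rewrite /d; lra.
have s0 : 0 < s by exact: side_gt0.
set sd := n%:R `^ (a - 1).
have sdE : s `^ d * s = sd.
  rewrite -{2}[s]powRr1 1?ltW// -powRD ?(gt_eqF s0) ?implybT//.
  rewrite /s /side -powRrM /sd; congr (_ `^ _).
  by rewrite /a /d; ring.
have sd0 : 0 < sd by exact: powR_gt0.
have w_top : weight d (s, s) = 2 * sd by rewrite /weight /= sdE; ring.
have w_thin j : j \in iota n k ->
    weight d (side t j, s - side t j) <= 2 * m^-1 * sd.
  rewrite mem_iota => /andP[nj jk].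
  have jr : j%:R <= (1 + rho) * n%:R :> R.
    rewrite mulrDl mul1r (le_trans (_ : _ <= (n + k)%:R))//.
      by rewrite ler_nat ltnW.
    by rewrite natrD lerD2l.
  have dr : 0 <= s - side t j <= rho * s.
    by apply: (@side_drop R t rho n j); rewrite ?n0 ?nj//; lra.
  apply: (@le_trans _ _ (weight d (s, rho * s))).
    apply: weight_le => //; first lra.
    by rewrite side_ge0 side_le ?n0 ?nj//; lra.
  have rhole : rho <= rho `^ d by apply: ger1_powR; lra.
  rewrite /weight /= powRM; [|lra..].
  rewrite [_ * (rho * s)]mulrCA sdE -mulrA sdE.
  nra.
have w_sum : \sum_(j <- iota n k) weight d (side t j, s - side t j) <=
    k%:R * (2 * m^-1 * sd).
  rewrite big_seq (le_trans (ler_sum _ w_thin))// -big_seq big_const_seq.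
  by rewrite iter_addr_0 count_predT size_iota -[leLHS]mulr_natl.
have kn0 : k%:R <= n%:R :> R by nra.
have grow := @powR_increment R a n%:R k%:R a01 n0R (ler0n _ _).
(* As [k <= n], the slope of the budget at [n + k] is at least half that at [n]. *)
have half : 2^-1 * sd <= (n%:R + k%:R) `^ (a - 1).
  have : (2 * n%:R) `^ (a - 1) <= (n%:R + k%:R) `^ (a - 1).
    by rewrite -(opprB 1 a); apply: powRN_le; lra.
  apply: le_trans; rewrite powRM// -/sd ler_wpM2r ?(ltW sd0)//.
  by rewrite -powR_inv1// ler_powR; lra.
have c0 : 0 < m * a by rewrite mulr_gt0; lra.
apply: (@le_trans _ _ (4 * (k%:R * m^-1) * sd)).
  have : 1 <= k%:R * m^-1 by rewrite ler_pdivlMr// mul1r.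
  rewrite w_top; move: w_sum.
  have -> : k%:R * (2 * m^-1 * sd) = 2 * ((k%:R * m^-1) * sd) by ring.
  set q := _ * m^-1; nra.
apply: (@le_trans _ _ (8 / (m * a) * (a * k%:R * (2^-1 * sd)))).
  by rewrite le_eqVlt; apply/orP; left; apply/eqP; field; lra.
rewrite ler_pM2l ?divr_gt0// natrD (le_trans _ grow)//.
by rewrite ler_wpM2l// mulr_ge0//; lra.
Qed.

(** * Tail sums, stack lengths and the wide box *)

Lemma sqr_side {R : realType} (t : R) n : (0 < n)%N ->
  side t n ^+ 2 = n%:R `^ (- (2 * t - 1) - 1).
Proof.
move=> n0; rewrite -powR_mulrn ?side_ge0// /side -powRrM.
by congr (_ `^ _); ring.
Qed.

Lemma side0 {R : realType} (t : R) : t != 0 -> side t 0 = 0.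
Proof. by move=> t0; rewrite /side powR0// oppr_eq0. Qed.

Lemma sum_sqr_side {R : realType} (t : R) n : 1 / 2 < t < 1 ->
  \sum_(0 <= j < n.+2) side t j ^+ 2 <=
  1 + (2 * t - 1)^-1 * (1 - n.+1%:R `^ (- (2 * t - 1))).
Proof.
move=> t12; set b := 2 * t - 1.
have b01 : 0 < b < 1 by rewrite /b; lra.
elim: n => [|n IHn].
  rewrite !big_nat_recr//= big_geq// side0 ?gt_eqF//; last by lra.
  by rewrite /side !powR1 subrr; lra.
rewrite big_nat_recr//=; apply: le_trans (lerD IHn (lexx _)) _.
rewrite sqr_side// -/b -addrA lerD2l -lerBrDl -mulrBr.
have n1 : 1 < n.+2%:R :> R by rewrite ltr1n.
have := powR_decrement b _ b01 n1.
have -> : n.+2%:R - 1 = n.+1%:R :> R by rewrite -[n.+2]addn1 natrD addrK.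
have b0 : 0 < b by lra.
rewrite -ler_pdivlMl//; move/le_trans; apply.
by rewrite ler_pM2l ?invr_gt0//; lra.
Qed.

(** The tail sums of the areas.  They are known only through these three
properties in all that follows. *)
Lemma side_tail {R : realType} (t : R) : 1 / 2 < t < 1 ->
  exists T : nat -> R, [/\ forall n, T n = side t n ^+ 2 + T n.+1,
    forall n, 0 <= T n & T @ \oo --> (0 : R)].
Proof.
move=> t12.
set u : R^nat := fun n => \sum_(0 <= j < n) side t j ^+ 2.
have uS n : u n.+1 = u n + side t n ^+ 2 by rewrite /u big_nat_recr.
have u_nd : nondecreasing_seq u.
  by apply/nondecreasing_seqP => n; rewrite uS lerDl sqr_ge0.
have u_cvg : cvgn u.
  apply: nondecreasing_is_cvgn => //.
  exists (1 + (2 * t - 1)^-1) => _ [n _ <-].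
  apply: (le_trans (u_nd n n.+2 (leqW (leqnSn n)))).

  apply: (le_trans (sum_sqr_side t n t12)).
  rewrite lerD2l; apply: ler_piMr; first by rewrite invr_ge0; lra.
  by rewrite lerBlDr lerDl powR_ge0.
exists (fun n => limn u - u n); split=> [n|n|].
- by rewrite uS; ring.
- by rewrite subr_ge0 nondecreasing_cvgn_le.
- rewrite -(subrr (limn u)); apply: cvgB => //; exact: cvg_cst.
Qed.

Lemma tail_split {R : realType} (s T : nat -> R) (n k : nat) :
  (forall j, T j = s j ^+ 2 + T j.+1) ->
  T n = \sum_(j <- iota n k) s j ^+ 2 + T (n + k)%N.
Proof.
move=> TS; elim: k n => [|k IHk] n; first by rewrite big_nil add0r addn0.
by rewrite /= big_cons TS IHk addrA addSnnS.
Qed.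

Lemma sum_iota_ge {R : realType} (s : nat -> R) (c : R) (n k : nat) :
  (forall j, (n <= j < n + k)%N -> c <= s j) ->
  k%:R * c <= \sum_(j <- iota n k) s j.
Proof.
move=> cs; have -> : k%:R * c = \sum_(j <- iota n k) c.
  by rewrite big_const_seq iter_addr_0 count_predT size_iota mulr_natl.
rewrite big_seq [leRHS]big_seq; apply: ler_sum => j.
by rewrite mem_iota; exact: cs.
Qed.

(** The terms with [n <= j < 2 n] suffice. *)
Lemma tail_ge {R : realType} (t : R) (T : nat -> R) (n : nat) : 0 < t < 1 ->
  (forall j, T j = side t j ^+ 2 + T j.+1) -> (forall j, 0 <= T j) -> (0 < n)%N ->
  4^-1 * n%:R `^ (1 - 2 * t) <= T n.
Proof.
move=> t01 TS T0 n0; rewrite (@tail_split R _ T n n TS).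
have n0R : 0 < n%:R :> R by rewrite ltr0n.
have low j : (n <= j < n + n)%N -> (2 * n%:R) `^ (- (2 * t)) <= side t j ^+ 2.
  move=> /andP[nj jn]; rewrite -powR_mulrn ?side_ge0// /side -powRrM.
  rewrite [- t * 2](_ : _ = - (2 * t)); last by ring.
  rewrite powRN_le//; [lra|by rewrite ltr0n; lia|].
  by rewrite -natrM ler_nat; lia.
have := @sum_iota_ge R _ _ n n low.
have : 4^-1 * n%:R `^ (1 - 2 * t) <= n%:R * (2 * n%:R) `^ (- (2 * t)).
  rewrite powRM// [leRHS]mulrCA -[X in _ <= _ * (X * _)](powRr1 (ltW n0R)).
  rewrite -powRD ?(gt_eqF n0R) ?implybT// ler_wpM2r ?powR_ge0//.
  rewrite (_ : 4^-1 = 2^-1 ^+ 2); last by field.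
  rewrite exprVn -powR_invn// ler_powR//; lra.
move: (T0 (n + n)%N); set S := \sum_(_ <- _) _; lra.
Qed.

(** The longest stack that fits in width [w].  As [w <= 1] and the sides up to
index [2 n] are at least [(2 n) ^ (- t)], it has at most [2 * n ^ t] squares,
which is a small fraction of [n]. *)
Lemma stack_length {R : realType} (t rho w : R) (n m : nat) : 0 < t < 1 ->
  (0 < n)%N -> 2 * n%:R `^ (t - 1) <= rho -> rho < 1 ->
  m%:R * side t n <= w <= 1 ->
  exists k : nat, [/\ (m <= k)%N, k%:R <= rho * n%:R,
    \sum_(j <- iota n k) side t j <= w
    & w - \sum_(j <- iota n k) side t j <= side t n].
Proof.
move=> t01 n0 nrho rho1 /andP[mw w1].
have n0R : 0 < n%:R :> R by rewrite ltr0n.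
pose P k := \sum_(j <- iota n k) side t j <= w.
(* Up to index [2 n] all sides are at least [(2 n) ^ (- t)]. *)
have short k : (k <= n)%N -> P k -> k%:R <= rho * n%:R.
  move=> kn Pk.
  have low j : (n <= j < n + k)%N -> (2 * n%:R) `^ (- t) <= side t j.
    move=> /andP[nj jn]; rewrite powRN_le//; [lra|by rewrite ltr0n; lia|].
    by rewrite -natrM ler_nat; lia.
  have := @sum_iota_ge R _ _ n k low.
  move=> /le_trans/(_ Pk)/le_trans/(_ w1).
  rewrite powRN ler_pdivrMr ?mul1r ?powR_gt0 ?mulr_gt0//.
  move/le_trans; apply; rewrite powRM//.
  have -> : n%:R `^ t = n%:R `^ (t - 1) * n%:R.
    rewrite -[X in _ = _ * X](powRr1 (ltW n0R)) -powRD ?subrK//.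
    by rewrite (gt_eqF n0R) implybT.
  rewrite mulrA ler_wpM2r// (le_trans _ nrho)// ler_wpM2r ?powR_ge0//.
  by rewrite ler1_powR; lra.
(* Otherwise [n] squares would fit, against [rho < 1]. *)
have P_le k : P k -> (k <= n)%N.
  move=> Pk; rewrite leqNgt; apply/negP => nk.
  have Pn : P n.
    apply: le_trans Pk; rewrite -(subnKC (ltnW nk)) iotaD big_cat /= lerDl.
    by apply: sumr_ge0 => j _; exact: side_ge0.
  have := short n (leqnn _) Pn; nra.
have Pm : P m.
  apply: le_trans mw.
  have low j : (n <= j < n + m)%N -> - side t n <= - side t j.
    by move=> /andP[nj _]; rewrite lerN2 side_le ?n0//; lra.
  have := @sum_iota_ge R (fun j => - side t j) _ n m low.
  by rewrite mulrN sumrN lerN2.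
have [k Pk kmax] := ex_maxnP (ex_intro P m Pm) P_le.
exists k; split=> //; [exact: kmax|exact: short (P_le _ Pk) Pk|].
have := contraNN (kmax k.+1); rewrite ltnn => /(_ isT).
rewrite /P -addn1 iotaD big_cat /= big_seq1 -ltNge => kw.
have : side t (n + k) <= side t n by rewrite side_le ?n0 ?leq_addr//; lra.
lra.
Qed.

(** If all boxes had a side at most [c], summing [thin_area] would bound the total
area by [c ^ (1 - d)] times the total weight. *)
Lemma exists_wide_box {R : realType} (d c : R) (L : seq (box R)) :
  0 <= d < 1 -> all (unit_dims \o dims) L ->
  c `^ (1 - d) * (\sum_(r <- L) weight d (dims r)) < \sum_(r <- L) area (dims r) ->
  exists2 r, r \in L & (c < (dims r).1) && (c < (dims r).2).
Proof.
move=> d01 /allP unitL; apply: contraPP => noL; apply/negP; rewrite -leNgt.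
rewrite mulr_sumr big_seq [leRHS]big_seq; apply: ler_sum => r rL.
move: (unitL r rL) => /= /andP[/andP[w0 _] /andP[h0 _]].
apply: thin_area => //; rewrite !leNgt -negb_and; apply/negP => wide.
by apply: noL; exists r.
Qed.

(** * One step of the packing *)

(** The bound [B * n ^ a] on the weight of the left-over boxes before square [n] is
placed, with the constant for which [stack_waste] balances. *)
Definition budget {R : realType} (t : R) (m n : nat) : R :=
  8 / (m%:R * (1 - t) ^+ 2) * n%:R `^ ((1 - t) ^+ 2).

(** The invariant of the construction: squares [1, ..., n - 1] are placed, in this
order, as [S], and [L] is what is left. *)
Definition stage {R : realType} (t : R) (m : nat) (T : nat -> R)
    (L0 : seq (box R)) (n : nat) (S L : seq (box R)) : Prop :=
  [/\ map dims S = [seq (side t j, side t j) | j <- iota 1 n.-1],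
      dissects L0 (S ++ L),
      all (unit_dims \o dims) L,
      \sum_(r <- L) area (dims r) = T n
    & \sum_(r <- L) weight (1 - t) (dims r) <= budget t m n].

(** The powers of [n] match because [- t * t + (1 - t) ^ 2 = 1 - 2 t]. *)
Lemma stage_has_wide_box {R : realType} (t : R) (m n : nat) (T : nat -> R)
    (L0 S L : seq (box R)) :
  0 < t < 1 -> (forall j, T j = side t j ^+ 2 + T j.+1) -> (forall j, 0 <= T j) ->
  m%:R `^ t * (8 / (m%:R * (1 - t) ^+ 2)) < 4^-1 ->
  (0 < n)%N -> stage t m T L0 n S L ->
  exists2 r, r \in L
    & (m%:R * side t n < (dims r).1) && (m%:R * side t n < (dims r).2).
Proof.
move=> t01 TS T0 mB n0 [_ _ unitL areaL weightL].
have n0R : 0 < n%:R :> R by rewrite ltr0n.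
apply: (@exists_wide_box R (1 - t)) => //; first lra.
rewrite areaL; apply: lt_le_trans (@tail_ge R t T n t01 TS T0 n0).
rewrite (_ : 1 - (1 - t) = t); last by ring.
apply: (@le_lt_trans _ _ ((m%:R * side t n) `^ t * budget t m n)).
  by rewrite ler_wpM2l ?powR_ge0.
rewrite powRM ?side_ge0// /budget.
rewrite (_ : 1 - 2 * t = - t * t + (1 - t) ^+ 2); last by ring.
rewrite powRD ?(gt_eqF n0R) ?implybT// (powRrM n%:R (- t) t) -/(side t n).
set x := side t n `^ t; set y := n%:R `^ _; set c := 8 / _.
have -> : m%:R `^ t * x * (c * y) = m%:R `^ t * c * (x * y) by ring.
by rewrite ltr_pM2r// mulr_gt0 ?powR_gt0 ?side_gt0.
Qed.

Lemma all_dims {R : realType} (P : pred (R * R)) (E : seq (box R))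
    (F : nat -> R * R) (s : seq nat) :
  map dims E = [seq F j | j <- s] -> {in s, forall j, P (F j)} ->
  all (P \o dims) E.
Proof.
move=> dE PF; have : all P (map dims E) by rewrite dE all_map; apply/allP.
by rewrite all_map.
Qed.

Lemma sum_dims {R : realType} (f : R * R -> R) (E : seq (box R))
    (F : nat -> R * R) (s : seq nat) :
  map dims E = [seq F j | j <- s] ->
  \sum_(r <- E) f (dims r) = \sum_(j <- s) f (F j).
Proof. by move=> dE; rewrite -(big_map dims xpredT f) dE big_map. Qed.

(** Cut a strip of height [side t n] from a wide box and stack squares in it.  What
remains of the box above the strip weighs no more than the box, so the total
weight grows by at most the waste of the stack. *)
Lemma next_stage {R : realType} (t rho : R) (m : nat) (T : nat -> R)
    (L0 : seq (box R)) (n : nat) (S L : seq (box R)) :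
  0 < t < 1 -> (forall j, T j = side t j ^+ 2 + T j.+1) -> (forall j, 0 <= T j) ->
  (0 < m)%N -> m%:R `^ t * (8 / (m%:R * (1 - t) ^+ 2)) < 4^-1 ->
  0 < rho < 1 -> rho `^ (1 - t) <= m%:R^-1 ->
  (0 < n)%N -> 2 * n%:R `^ (t - 1) <= rho ->
  stage t m T L0 n S L ->
  exists (k : nat) (S' L' : seq (box R)),
    (0 < k)%N /\ stage t m T L0 (n + k) (S ++ S') L'.
Proof.
move=> t01 TS T0 m0 mB rho01 rhom n0 nrho stageL.
have [r rL] := @stage_has_wide_box R t m n T L0 S L t01 TS T0 mB n0 stageL.
case: stageL => dS cutL unitL areaL weightL.
have m1 : 1 <= m%:R :> R by rewrite ler1n.
set s := side t n; have s0 : 0 < s by exact: side_gt0.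
have ms : s <= m%:R * s by rewrite ler_peMl// ltW.
have : unit_dims (dims r) by exact: (allP unitL).
have : all (unit_dims \o dims) (rem r L).
  by apply/allP => z /mem_rem; exact: (allP unitL).
have := perm_to_rem rL; move: (rem r L) => L1 permL unitL1.
case: r rL permL => -[x y] [w h] /= rL permL.
move=> /andP[/= /andP[w0 w1] /andP[h0 h1]] /andP[mw mh].
have sh : 0 <= s <= h by lra.
have [k [mk krho kw kW]] : exists k : nat, [/\ (m <= k)%N, k%:R <= rho * n%:R,
    \sum_(j <- iota n k) side t j <= w
    & w - \sum_(j <- iota n k) side t j <= s].
  by apply: (@stack_length R t rho w n m) => //; [lra|rewrite -/s w1 andbT ltW].
have side_s j : (n <= j)%N -> side t j <= s.
  by move=> nj; apply: side_le; [lra|rewrite n0].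
have [Q [E [e [dQ dE de cutQ]]]] :=
  @dissects_strip R (side t) k n x y w s (side_ge0 t) side_s kw.
have cutr : dissects [:: ((x, y), (w, h))]
    (((x, y + s), (w, h - s)) :: e :: Q ++ E).
  apply: dissects_trans (dissects_hcut x y w h s sh) _.
  apply: dissects_trans (dissects_cat _ _ _ _ cutQ (dissects_refl _)) _.
  by apply: dissects_perm; apply/permP => a; rewrite /= !count_cat /=; clear; lia.
exists k, Q, (((x, y + s), (w, h - s)) :: e :: E ++ L1).
split; first exact: leq_trans mk.
have sum0 : 0 <= \sum_(j <- iota n k) side t j.
  by apply: sumr_ge0 => j _; exact: side_ge0.
split.
- rewrite map_cat dS dQ -map_cat; congr map.
  have -> : (n + k).-1 = (n.-1 + k)%N by rewrite -[in LHS](prednK n0).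
  by rewrite iotaD add1n prednK.
- apply: dissects_trans cutL _.
  apply: (@dissects_trans _ _ (S ++ [:: ((x, y), (w, h))] ++ L1)).
    by apply: dissects_cat (dissects_refl _) _; exact: dissects_perm.
  rewrite -catA; apply: dissects_cat (dissects_refl _) _.
  apply: dissects_trans (dissects_cat _ _ _ _ cutr (dissects_refl _)) _.
  apply: dissects_perm; apply/permP => a.
  by rewrite /= !count_cat /= count_cat; clear; lia.
- have unitE : all (unit_dims \o dims) E.
    apply: (all_dims _ _ _ _ dE) => j; rewrite mem_iota => /andP[nj _].
    have := side_s j nj; have := side_ge0 t j.
    have : s <= 1 by apply: side_le1 => //; lra.
    by rewrite /unit_dims /=; lra.
  have s1 : s <= 1 by lra.
  rewrite -[X in all _ X]/([:: ((x, y + s), (w, h - s)); e] ++ E ++ L1).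
  by rewrite !all_cat unitE unitL1 /= de /unit_dims /= !andbT; lra.
- case: cutr => + _ _; rewrite !big_cons big_cat big_nil /= addr0.
  rewrite (sum_dims area _ _ _ dQ).
  move: areaL; rewrite (perm_big _ permL) !big_cons big_cat /= => areaL areaQ.
  rewrite (@tail_split R _ T n k TS) in areaL.
  have eqQ : \sum_(j <- iota n k) area (side t j, side t j) =
             \sum_(j <- iota n k) side t j ^+ 2 by [].
  rewrite eqQ in areaQ; lra.
- move: weightL; rewrite (perm_big _ permL) !big_cons big_cat /= => weightL.
  rewrite (sum_dims (weight (1 - t)) _ _ _ dE) de.
  have t1 : 0 <= 1 - t by lra.
  have top : weight (1 - t) (w, h - s) <= weight (1 - t) (w, h).
    by apply: weight_le => //; lra.
  have rest : weight (1 - t) (w - \sum_(j <- iota n k) side t j, s) <=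
      weight (1 - t) (s, s).
    by apply: weight_le => //; lra.
  have rho01' : 0 < rho <= 1 by lra.
  have mk' : m%:R <= k%:R :> R by rewrite ler_nat.
  have m0' : 0 < m%:R :> R by rewrite ltr0n.
  have := @stack_waste R t rho m%:R n k t01 m0' n0 mk' rho01' rhom krho.
  move: weightL; rewrite /budget mulrBr; lra.
Qed.

(** * Regions, null sets and elementary bounds *)

Definition covered {R : realType} (L : seq (box R)) : set (R * R) :=
  [set p | has (in_closed p) L].

Lemma region_in_closed {R : realType} (r : box R) p :
  region r p <-> in_closed p r.
Proof.
rewrite /region /rectangle /in_closed /= !in_itv /=.
by split=> [[-> ->]|/andP[-> ->]].
Qed.

(** Slicing a product neighbourhood of [p] along each coordinate gives
neighbourhoods of [p.1] and [p.2] in the two intervals. *)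
Lemma interior_region {R : realType} (r : box R) p :
  (region r)° p -> in_open p r.
Proof.
move=> [[A B] /= [nA nB] AB].
have /= Bp := nbhs_singleton nB; have /= Ap := nbhs_singleton nA.
have : (`[r.1.1, r.1.1 + r.2.1]%classic)° p.1.
  by apply: filterS nA => a Aa; have /= [] := AB (a, p.2) (conj Aa Bp).
have : (`[r.1.2, r.1.2 + r.2.2]%classic)° p.2.
  by apply: filterS nB => b Bb; have /= [] := AB (p.1, b) (conj Ap Bb).
by rewrite !interior_itv_bnd /= !in_itv /= /in_open => -> ->.
Qed.

Lemma measurable_region {R : realType} (r : box R) :
  measurable (region r : set (measurableTypeR R * measurableTypeR R)).
Proof. by apply: measurableX; exact: measurable_itv. Qed.

Lemma covered_cons {R : realType} (r : box R) L :
  covered (r :: L) = region r `|` covered L.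
Proof.
apply/seteqP; split=> p /=; rewrite /covered /=.
  by move=> /orP[/region_in_closed|]; [left|right].
by move=> [/region_in_closed ->|->] //; rewrite orbT.
Qed.

Lemma measurable_covered {R : realType} (L : seq (box R)) :
  measurable (covered L : set (measurableTypeR R * measurableTypeR R)).
Proof.
elim: L => [|r L IHL].
  by rewrite (_ : covered [::] = set0)//; apply/seteqP; split.
by rewrite covered_cons; apply: measurableU => //; exact: measurable_region.
Qed.

Lemma measure_region {R : realType} (r : box R) :
  0 <= (dims r).1 -> 0 <= (dims r).2 ->
  (@lebesgue_measure R \x @lebesgue_measure R)%E (region r) = (area (dims r))%:E.
Proof.
case: r => [[x y] [w h]] /= w0 h0; rewrite /region /rectangle /=.
rewrite product_measure1E; [|exact: measurable_itv..].
have itvE (a l : R) : 0 <= l ->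
    lebesgue_measure `[a, a + l]%classic = l%:E.
  move=> l0; rewrite lebesgue_measure_itv /= lte_fin ltrDl.
  case: ltP => [_|l0']; first by rewrite -EFinD addrAC subrr add0r.
  by congr EFin; apply/eqP; rewrite eq_le l0.
rewrite /area /= EFinM; congr (_ * _)%E; exact: itvE.
Qed.

Lemma measure_covered {R : realType} (L : seq (box R)) :
  all (unit_dims \o dims) L ->
  ((@lebesgue_measure R \x @lebesgue_measure R) (covered L) <=
   (\sum_(r <- L) area (dims r))%:E)%E.
Proof.
elim: L => [_|r L IHL /andP[/= unit_r unitL]].
  rewrite big_nil (_ : covered [::] = set0); last by apply/seteqP; split.
  by rewrite measure0.
rewrite covered_cons big_cons EFinD.
apply: (le_trans (measureU2 _ (measurable_region r) (measurable_covered L))).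
move: unit_r => /andP[/andP[w0 _] /andP[h0 _]].
apply: leeD; last exact: IHL.
by rewrite le_eqVlt; apply/orP; left; apply/eqP; exact: measure_region.
Qed.

(** Intersecting covers of area at most [1 / (i + 1)] gives a Borel null set that
contains [N]. *)
Lemma null_of_small_covers {R : realType} (N : set (R * R)) :
  (forall e : R, 0 < e -> exists L : seq (box R),
    [/\ all (unit_dims \o dims) L, N `<=` covered L
      & \sum_(r <- L) area (dims r) <= e]) ->
  lebesgue_null2 N.
Proof.
move=> small.
have /choice[F FP] : forall i : nat, exists L : seq (box R),
    [/\ all (unit_dims \o dims) L, N `<=` covered L
      & \sum_(r <- L) area (dims r) <= i.+1%:R^-1].
  by move=> i; apply: small; rewrite invr_gt0.
exists (\bigcap_i covered (F i)); split.
- by apply: bigcapT_measurable => i; exact: measurable_covered.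
- apply/eqP; rewrite eq_le measure_ge0 andbT.
  apply/lee_addgt0Pr => e e0; rewrite add0e.
  have [k ke] := ltr_add_invr e0; rewrite add0r in ke.
  have [unitF _ areaF] := FP k.
  apply: (@le_trans _ _
    ((@lebesgue_measure R \x @lebesgue_measure R)%E (covered (F k)))).
    apply: le_measure; rewrite ?inE; [|exact: measurable_covered|].
      by apply: bigcapT_measurable => i; exact: measurable_covered.
    by move=> p; apply.
  apply: (le_trans (measure_covered _ unitF)).
  by rewrite lee_fin (le_trans areaF)// ltW.
- by move=> p Np i _; have [_ + _] := FP i; apply.
Qed.

Lemma count_le1 {T : eqType} (P : pred T) (s : seq T) : uniq s ->
  {in s &, forall i j, P i -> P j -> i = j} -> (count P s <= 1)%N.
Proof.
elim: s => [//|i s IHs] /= /andP[i_s us] Pinj.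
have IH : (count P s <= 1)%N.
  by apply: IHs => // a b sa sb; apply: Pinj; rewrite inE ?sa ?sb orbT.
have [Pi|//] := boolP (P i); rewrite add1n ltnS leqn0 -[_ == _]negbK -lt0n -has_count.
apply/hasPn => j sj; apply/negP => Pj; move/negP: i_s; apply.
by rewrite (Pinj i j)// inE ?eqxx ?sj ?orbT.
Qed.

Lemma count_ge2 {T : Type} (P : pred T) (x0 : T) (s : seq T) i j :
  (i < j < size s)%N -> P (nth x0 s i) -> P (nth x0 s j) -> (1 < count P s)%N.
Proof.
move=> /andP[ij js] Pi Pj; rewrite -(cat_take_drop j s) count_cat.
have i_take : has P (take j s).
  apply/(has_nthP x0); exists i; first by rewrite size_take js.
  by rewrite nth_take.
have j_drop : has P (drop j s) by rewrite (drop_nth x0 js) /= Pj.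
by move: i_take j_drop; rewrite !has_count => *; exact: (@leq_add 1 1).
Qed.

Lemma powR_unbounded {R : realType} (c C : R) : 0 < c ->
  exists N : nat, forall n, (N <= n)%N -> C <= n%:R `^ c.
Proof.
move=> c0; exists (Num.bound (`|C| `^ c^-1)) => n Nn.
apply: (le_trans (ler_norm C)).
have -> : `|C| = (`|C| `^ c^-1) `^ c by rewrite -powRrM mulVf ?gt_eqF// powRr1.
apply: ge0_ler_powR; rewrite ?nnegrE ?powR_ge0 ?(ltW c0)//.
by apply/ltW/(lt_le_trans (archi_boundP (powR_ge0 _ _))); rewrite ler_nat.
Qed.

(** * Initial boxes, parameters and the limit *)

(** Squares of side at most 1 with lower left corners at distance 2. *)
Definition spaced_box {R : realType} (f : nat -> R) (j : nat) : box R :=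
  ((2 * j%:R, 0), (f j, f j)).

Lemma spaced_boxes_disjoint {R : realType} (f : nat -> R) (n : nat) p :
  (forall j, f j <= 1) ->
  (count (in_open p) [seq spaced_box f j | j <- iota 0 n] <= 1)%N.
Proof.
move=> f1; rewrite count_map; apply: count_le1; first exact: iota_uniq.
move=> i j _ _ /= /andP[/andP[/= ip pi] _] /andP[/andP[/= jp pj] _].
have := f1 i; have := f1 j => fj fi.
have : 2 * i%:R < 2 * j%:R + 1 :> R by lra.
have : 2 * j%:R < 2 * i%:R + 1 :> R by lra.
by rewrite -!natrM !natr1 !ltr_nat; lia.
Qed.

(** Dependent choice.  The squares already placed are never moved, so each list of
squares is a prefix of the next one. *)
Lemma stage_chain {R : realType} (t : R) (m : nat) (T : nat -> R)
    (Lst : seq (box R)) (n0 : nat) (S0 L0 : seq (box R)) :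
  stage t m T Lst n0 S0 L0 ->
  (forall n S L, (n0 <= n)%N -> stage t m T Lst n S L ->
    exists (k : nat) (S' L' : seq (box R)),
      (0 < k)%N /\ stage t m T Lst (n + k) (S ++ S') L') ->
  exists (n : nat -> nat) (S L : nat -> seq (box R)),
    forall i, [/\ (n0 + i <= n i)%N, stage t m T Lst (n i) (S i) (L i)
      & exists S', S i.+1 = S i ++ S'].
Proof.
move=> start step.
pose X := (nat * seq (box R) * seq (box R))%type.
pose ok (x : X) := (n0 <= x.1.1)%N /\ stage t m T Lst x.1.1 x.1.2 x.2.
(* The step is made total by letting it be arbitrary off the invariant. *)
have /choice[next nextP] : forall x : X, exists y : X, ok x ->
    [/\ ok y, (x.1.1 < y.1.1)%N & exists S', y.1.2 = x.1.2 ++ S'].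
  move=> x; have [okx|nok] := pselect (ok x); last by exists x => /nok.
  have [k [S' [L' [k0 st]]]] := step _ _ _ okx.1 okx.2.
  exists ((x.1.1 + k)%N, x.1.2 ++ S', L') => _; split=> /=.
  - by split=> //=; exact: leq_trans okx.1 (leq_addr _ _).
  - by rewrite -[ltnLHS]addn0 ltn_add2l.
  - by exists S'.
pose u i := iter i next (n0, S0, L0).
have uok i : ok (u i).
  elim: i => [|i IHi]; first by split.
  by have [] := nextP (u i) IHi.
exists (fun i => (u i).1.1), (fun i => (u i).1.2), (fun i => (u i).2) => i.
have [_ st] := uok i; split=> //.
- elim: i {st} => [|i IHi]; first by rewrite addn0.
  by have [_ lt_u _] := nextP (u i) (uok i); rewrite addnS (leq_ltn_trans IHi).
- by have [_ _ ?] := nextP (u i) (uok i).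
Qed.

Lemma nth_prefix_chain {X : Type} (x0 : X) (S : nat -> seq X) :
  (forall i, exists S', S i.+1 = S i ++ S') ->
  forall i i' l, (l < size (S i))%N -> (l < size (S i'))%N ->
  nth x0 (S i) l = nth x0 (S i') l.
Proof.
move=> Sext.
have mono i k : exists S', S (i + k)%N = S i ++ S'.
  elim: k => [|k [S' IHk]]; first by exists [::]; rewrite addn0 cats0.
  have [S'' Sik] := Sext (i + k)%N.
  by exists (S' ++ S''); rewrite addnS Sik IHk catA.
have main i i' l : (i <= i')%N -> (l < size (S i))%N ->
    nth x0 (S i) l = nth x0 (S i') l.
  move=> /subnKC <- li; have [S' ->] := mono i (i' - i)%N.
  by rewrite nth_cat li.
move=> i i' l li li'; have [/main->//|/ltnW/main->//] := leqP i i'.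
Qed.

(** First [m] is taken so large that [8 / a * m ^ (t - 1) < 1 / 4], which is where
[t < 1] enters; then [rho] solves [rho ^ (1 - t) = 1 / m], and [n0] is taken so
large that stacks are short relative to [n] and that a square of area [T n0]
fits the side bound 1 and the weight budget. *)
Lemma parameters {R : realType} (t : R) (T : nat -> R) : 1 / 2 < t < 1 ->
  T @ \oo --> (0 : R) ->
  exists (m n0 : nat) (rho : R),
    [/\ (0 < m)%N, m%:R `^ t * (8 / (m%:R * (1 - t) ^+ 2)) < 4^-1 :> R,
        0 < rho < 1 & rho `^ (1 - t) <= m%:R^-1] /\
    [/\ (0 < n0)%N, forall n, (n0 <= n)%N -> 2 * n%:R `^ (t - 1) <= rho,
        2 <= budget t m n0 & T n0 <= 1].
Proof.
move=> t12 T0; set a := (1 - t) ^+ 2.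
have a0 : 0 < a by rewrite exprn_gt0; lra.
have t1 : 0 < 1 - t by lra.
have [N NP] := @powR_unbounded R (1 - t) (33 / a) t1.
pose m := maxn N 2; have m1 : 1 < m%:R :> R by rewrite ltr1n leq_maxr.
have m0 : 0 < m%:R :> R by lra.
have mV : 0 < (m%:R^-1 : R) < 1 by rewrite invr_gt0 m0 invf_lt1.
pose rho : R := m%:R^-1 `^ (1 - t)^-1.
have rho0 : 0 < rho by rewrite powR_gt0//; lra.
have [N1 N1P] := @powR_unbounded R (1 - t) (2 / rho) t1.
have ma0 : 0 < m%:R * a by rewrite mulr_gt0.
have [N2 N2P] := @powR_unbounded R a (2 / (8 / (m%:R * a))) a0.
have [N3 _ N3P] : \forall n \near \oo, T n <= 1 by apply: cvgr_le T0 _ ltr01.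
exists m, (maxn N1 (maxn N2 (maxn N3 1))), rho; split; split.
- by rewrite leq_max orbT.
- have -> : m%:R `^ t * (8 / (m%:R * a)) = 8 / a / m%:R `^ (1 - t).
    rewrite powRB ?powRr1 ?(ltW m0)// ?(gt_eqF m0) ?implybT//.
    have := powR_gt0 t m0; set q := _ `^ t => q0; field; lra.
  have := NP m (leq_maxl _ _) => mge.
  have p0 : 0 < m%:R `^ (1 - t) :> R by exact: powR_gt0.
  rewrite ltr_pdivrMr// -ltr_pdivrMl ?invr_gt0// invrK.
  apply: lt_le_trans mge.
  have : 0 < a^-1 by rewrite invr_gt0.
  lra.
- have powr1 : 1 `^ (1 - t)^-1 = 1 :> R by rewrite powR1.
  by rewrite rho0 /= /rho -[ltRHS]powr1 gt0_ltr_powR ?invr_gt0 ?nnegrE//; lra.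
- by rewrite /rho -powRrM mulVf ?gt_eqF// powRr1//; lra.
- by rewrite !leq_max /= !orbT.
- move=> n; rewrite geq_max => /andP[/N1P n_rho _].
  rewrite -(opprB 1 t) powRN ler_pdivrMr; last first.
    by apply: lt_le_trans n_rho; rewrite divr_gt0.
  by rewrite mulrC -ler_pdivrMr.
- rewrite /budget mulrC -ler_pdivrMr ?divr_gt0//.
  by apply: N2P; rewrite leq_max leq_max leqnn orbT.
- by apply: N3P => /=; rewrite !leq_max leqnn !orbT.
Qed.

Theorem mainTheorem2 (R : realType) (t : R) (ht : 1 / 2 < t < 1) :
  exists Omega : set (R * R),
    is_finite_union_of_squares Omega /\
    squares_can_perfectly_pack [set n : nat | (1 <= n)%N]
      (fun n : nat => n%:R `^ (- t)) Omega.
Proof.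
have [T [TS T_ge0 T_cvg0]] := @side_tail R t ht.
have [m [n0 [rho [[m0 mB rho01 rhom] [n0_gt0 n_rho budget2 Tn0]]]]] :=
  @parameters R t T ht T_cvg0.
have t01 : 0 < t < 1 by lra.
have Tn0_gt0 : 0 < T n0.
  rewrite TS; apply: ltr_wpDr; first exact: T_ge0.
  by rewrite exprn_gt0 ?side_gt0.
pose q := Num.sqrt (T n0).
have q01 : 0 < q <= 1.
  by rewrite sqrtr_gt0 Tn0_gt0 -[leRHS]sqrtr1 ler_wsqrtr.
(* Index 0 is the square to be filled by the tail; the others stay as they are. *)
pose f j := if j == 0%N then q else side t j.
have f_gt0 j : 0 < f j.
  rewrite /f; case: eqP => [_|/eqP]; first lra.
  by rewrite -lt0n => j0; exact: side_gt0.
have f_le1 j : f j <= 1.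
  rewrite /f; case: eqP => [_|/eqP]; first lra.
  by rewrite -lt0n => j0; apply: side_le1 => //; lra.
pose start := [seq spaced_box f j | j <- iota 0 n0].
pose S0 := [seq spaced_box f j | j <- iota 1 n0.-1].
have startE : start = spaced_box f 0 :: S0 by rewrite /start -{1}(prednK n0_gt0).
have stage0 : stage t m T start n0 S0 [:: spaced_box f 0].
  split.
  - rewrite -map_comp; apply/eq_in_map => j; rewrite mem_iota => /andP[j1 _].
    by rewrite /= /f; case: eqP => // j0; rewrite j0 in j1.
  - rewrite startE; apply: dissects_perm.
    by rewrite -cat1s perm_catC.
  - by rewrite /unit_dims /= /f /=; lra.
  - by rewrite big_seq1 /area /= /f /= -expr2 sqr_sqrtr// ltW.
  - rewrite big_seq1; apply: le_trans budget2; rewrite /= /f /=.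
    apply: (@le_trans _ _ (weight (1 - t) (1, 1))).
      by apply: weight_le; lra.
    by rewrite /weight /= powR1 !mulr1.
(* All hypotheses of [next_stage] that involve [n] persist for [n >= n0]. *)
have [n [S [L chain]]] := @stage_chain R t m T start n0 S0 _ stage0
  (fun n S L hn st => @next_stage R t rho m T start n S L t01 TS T_ge0 m0 mB
    rho01 rhom (leq_trans n0_gt0 hn) (n_rho n hn) st).
pose b0 : box R := ((0, 0), (0, 0)).
have sizeS i : size (S i) = (n i).-1.
  have [_ [dS _ _ _ _] _] := chain i.
  by have := congr1 size dS; rewrite !size_map size_iota.
have ltS i : (i <= size (S i))%N.
  by rewrite sizeS; have [+ _ _] := chain i; move: n0_gt0; clear; lia.
have nthS := @nth_prefix_chain _ b0 S (fun i => let: And3 _ _ h := chain i in h).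
(* Square [j] is entry [j - 1] of every list long enough, in particular of [S j]. *)
pose Q j := nth b0 (S j) j.-1.
have QE i l : (l < size (S i))%N -> nth b0 (S i) l = Q l.+1.
  by move=> li; apply: nthS => //; exact: ltS l.+1.
have dimsQ j : (1 <= j)%N -> dims (Q j) = (side t j, side t j).
  move=> j1; have [_ [dS _ _ _ _] _] := chain j.
  have lj : (j.-1 < size (S j))%N by rewrite prednK// ltS.
  rewrite /Q -(nth_map b0 (dims b0))// dS (nth_map 0%N) ?size_iota -?sizeS//.
  by rewrite nth_iota -?sizeS// add1n prednK.
exists (covered start); split.
  exists [set region r | r in [set` start]]; split.
  - exact/finite_image/finite_seq.
  - move=> _ [r /= /mapP[j _ ->] <-]; exists (f j); split; first exact: f_gt0.
    by exists (2 * j%:R), 0.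
  - apply/seteqP; split=> p.
      move=> /hasP[r rs pr]; exists (region r); first by exists r.
      exact/region_in_closed.
    by move=> [_ [r rs <-] /region_in_closed pr]; apply/hasP; exists r.
exists (fun j => region (Q j)); split.
  move=> j j1; split; first exact: side_gt0.
  have := dimsQ j j1; rewrite /region; case: (Q j) => [[x y] wh] /= ->.
  by exists x, y.
split; last first.
  apply: null_of_small_covers => e e0.
  have [N _ NP] : \forall n \near \oo, T n <= e by apply: cvgr_le T_cvg0 _ e0.
  have [Nn [_ [_ _ cut] unitL areaL _] _] := chain N.
  exists (L N); split=> //.
    move=> p [+ pQ]; rewrite /covered /= cut has_cat => /orP[|//].
    move=> /(has_nthP b0)[l lS]; rewrite QE// => /region_in_closed pl.
    by exfalso; apply: pQ; exists l.+1.
  by rewrite areaL; apply: NP; move: Nn; clear; rewrite /=; lia.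
split.
- exact: countableP.
- move=> j j1; have := dimsQ j j1; rewrite /region.
  case: (Q j) => [[x y] wh] /= ->.
  by exists x, y, (side t j), (side t j); split; rewrite ?side_gt0.
- move=> j j1 p /region_in_closed pj.
  have [_ [_ [_ _ cut] _ _ _] _] := chain j.
  rewrite /covered /= cut has_cat; apply/orP; left.
  by apply/(has_nthP b0); exists j.-1 => //; rewrite prednK// ltS.
- (* At time [j] both squares are in [S j], and no point is in two open boxes. *)
- have no_meet i j : (1 <= i)%N -> (i < j)%N ->
      forall p, ~ (in_open p (Q i) /\ in_open p (Q j)).
    move=> i1 ij p [pi pj]; have [_ [_ [_ cut _] _ _ _] _] := chain j.
    have := leq_trans (cut p) (@spaced_boxes_disjoint R f n0 p f_le1).
    apply/negP; rewrite -ltnNge count_cat (leq_trans _ (leq_addr _ _))//.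
    apply: (@count_ge2 _ _ b0 _ i.-1 j.-1).
    + by have := ltS j; move: i1 ij; clear; lia.
    + by rewrite QE ?prednK//; have := ltS j; move: i1 ij; clear; lia.
    + exact: pj.
  move=> i j i1 j1 [p [/interior_region pi /interior_region pj]].
  have [ij|ji|//] := ltngtP i j.
    by case: (no_meet i j i1 ij p).
  by case: (no_meet j i j1 ji p).
Qed.
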